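(* Let $n\ge1$, $\mathbf s\in\mathbb N^n$. For any two $\mathbf s$-arcs $\alpha,\alpha'$, the join irreducible $\mathbf s$-tree $\mathcal T_\vee(\alpha)$ forces $\mathcal T_\vee(\alpha')$ in the $\mathbf s$-weak order if and only if $\alpha$ is a subarc of $\alpha'$. That is, the forcing order on join irreducible $\mathbf s$-trees coincides with the subarc order on $\mathbf s$-arcs.
   Context: $[n]=\{1,\dots,n\}$, $]i,j[=\{i+1,\dots,j-1\}$, $\mathbf s=(s_1,\dots,s_n)$, $s_i\in\mathbb N$ (zeros allowed). An $\mathbf s$-tree is a rooted plane tree with internal nodes labeled bijectively by $[n]$, root with one child, node $j$ with $s_j+1$ ordered children each a leaf or a node $>j$. $\mathrm{pos}(\mathcal T,i,j)$ ($i<j$) = min of $s_i$ and the number of outgoing edges of $i$ strictly right of the path from the root to $j$. $\mathbf s$-weak order: $\mathcal T\le\mathcal T'$ iff $\mathrm{pos}(\mathcal T,i,j)\le\mathrm{pos}(\mathcal T',i,j)$ for all $i<j$; it is a finite lattice. Congruences and forcing: a congruence of a lattice $L$ is an equivalence relation with $x\equiv x',y\equiv y'\Rightarrow x\vee y\equiv x'\vee y'$ and $x\wedge y\equiv x'\wedge y'$. A join irreducible $j$ (covering a unique element $j_*$) is contracted by $\equiv$ if $j\equiv j_*$. For join irreducibles $j,j'$, $j$ forces $j'$ if every congruence contracting $j$ also contracts $j'$. $\mathbf s$-arcs: $(i,j,A,B,r)$ with $1\le i<j\le n$, $A\sqcup B=\{k\in]i,j[:s_k\ne0\}$, $r\in\{1,\dots,s_i\}$.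 Combs: the right $\mathbf s$-comb on $J\subseteq[n]$ is the increasing tree on $J$ where each $j\in J$ has $s_j+1$ outgoing edges, all leaves except the rightmost, which goes to the next element of $J$. $\mathcal T_\vee(i,j,A,B,r)$ is obtained from the right comb on $[n]\setminus(A\cup\{j\})$ by replacing the $(r+1)$-st outgoing edge of $i$ counted from the right (a leaf) by the right comb on $A\cup\{j\}$; these are exactly the join irreducible $\mathbf s$-trees. Subarcs: $\alpha=(i,j,A,B,r)$ is a subarc of $\alpha'=(i',j',A',B',r')$ if $i'\le i<j\le j'$; $A\subseteq A'$ and $B\subseteq B'$; if $s_j=0$ then $j=j'$; if $i'=i$ then $r=r'$; if $i'<i$ then either ($i\in A'$ and $r=1$) or ($i\in B'$ and $r=s_i$). *)

(* Defs.v *)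
From HB Require Import structures.
From mathcomp Require Import all_boot all_order.
From mathcomp Require Import zify.

Set Implicit Arguments.
Unset Strict Implicit.
Unset Printing Implicit Defensive.

Import Order.TTheory.

(* Labels are 0-based: the label m of [n] = {1, .., n} is the ordinal of value
   m - 1.  The root and its single outgoing edge are left implicit: a [ptree]
   is what hangs from that edge. *)
Inductive ptree (n : nat) : Type :=
  | Leaf
  | Node of 'I_n & seq (ptree n).
Arguments Leaf {n}.

Section PlaneTreeInduction.
Variables (n : nat) (P : ptree n -> Prop).
Hypothesis PLeaf : P Leaf.
Hypothesis PNode : forall j c,
  (forall k, k < size c -> P (nth Leaf c k)) -> P (Node j c).

Fixpoint ptree_nested_ind (t : ptree n) : P t :=
  match t with
  | Leaf => PLeaf
  | Node j c => PNode j
      ((fix loop (c : seq (ptree n)) :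
          forall k, k < size c -> P (nth Leaf c k) :=
        match c return forall k, k < size c -> P (nth Leaf c k) with
        | [::] => fun k (h : k < 0) => False_ind _ (notF h)
        | u :: c' => fun k =>
            match k return k < (size c').+1 -> P (nth Leaf (u :: c') k) with
            | 0 => fun _ => ptree_nested_ind u
            | k'.+1 => loop c' k'
            end
        end) c)
  end.
End PlaneTreeInduction.

Section PlaneTreeChoice.
Variable n : nat.

Fixpoint gentree_of_ptree (t : ptree n) : GenTree.tree unit :=
  match t with
  | Leaf => GenTree.Leaf tt
  | Node j c => GenTree.Node j [seq gentree_of_ptree u | u <- c]
  end.

Fixpoint ptree_of_gentree (g : GenTree.tree unit) : ptree n :=
  match g with
  | GenTree.Leaf _ => Leaf
  | GenTree.Node k c =>
      let c' := [seq ptree_of_gentree u | u <- c] in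
      if insub k is Some j then Node j c' else Leaf
  end.

Lemma gentree_of_ptreeK : cancel gentree_of_ptree ptree_of_gentree.
Proof.
elim/ptree_nested_ind => [//|j c IH] /=.
rewrite insubT //= => jn; congr Node; first exact/val_inj.
rewrite -map_comp; apply: (@eq_from_nth _ Leaf); rewrite size_map // => k kc.
by rewrite (nth_map Leaf) //= IH.
Qed.

HB.instance Definition _ := Countable.copy (ptree n) (can_type gentree_of_ptreeK).
End PlaneTreeChoice.

Fixpoint labels n (t : ptree n) : seq 'I_n :=
  if t is Node j c then j :: flatten [seq labels u | u <- c] else [::].

Definition root_gt n (j : 'I_n) (t : ptree n) : bool :=
  if t is Node k _ then j < k else true.

Fixpoint is_increasing n (s : 'I_n -> nat) (t : ptree n) : bool :=
  if t is Node j c then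
    [&& size c == (s j).+1, all (root_gt j) c & all (is_increasing s) c]
  else true.

Definition is_stree n (s : 'I_n -> nat) (t : ptree n) : bool :=
  is_increasing s t && perm_eq (labels t) (enum 'I_n).

Record stree n (s : 'I_n -> nat) : Type :=
  STree { stree_val : ptree n; stree_valP : is_stree s stree_val }.

HB.instance Definition _ n (s : 'I_n -> nat) := [isSub for @stree_val n s].
HB.instance Definition _ n (s : 'I_n -> nat) := [Choice of stree s by <:].

(* A path from the root is the sequence of the ranks, from the left and from
   0, of the edges it follows; [addr t j] is the path to the node [j]. *)
Fixpoint addr n (t : ptree n) (j : 'I_n) : seq nat :=
  if t is Node i c then
    if i == j then [::]
    else let k := find (fun u => j \in labels u) c in
         k :: nth [::] [seq addr u j | u <- c] k
  else [::].

Fixpoint strictly_right (p q : seq nat) : bool :=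
  match p, q with
  | x :: p', y :: q' => (y < x) || ((x == y) && strictly_right p' q')
  | _, _ => false
  end.

(* Capped by [s i] for a [j] lying to the left of [i], where all the [s i + 1]
   outgoing edges of [i] are on the right of the path to [j]. *)
Definition pos n (s : 'I_n -> nat) (t : ptree n) (i j : 'I_n) : nat :=
  minn (s i) #|[set k : 'I_(s i).+1 |
                 strictly_right (rcons (addr t i) k) (addr t j)]|.

Section Pos.
Variables (n : nat) (s : 'I_n -> nat).
Implicit Types (t u : ptree n) (i j l : 'I_n) (c : seq (ptree n)).

Definition slot c l := find (fun u => l \in labels u) c.

Lemma pos_le t i j : pos s t i j <= s i.
Proof. exact: geq_minl. Qed.

Lemma posE t i j : pos s t i j = minn (s i)
  (count (fun x => strictly_right (rcons (addr t i) x) (addr t j))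
    (iota 0 (s i).+1)).
Proof.
rewrite /pos -val_enum_ord count_map enumT cardsE cardE /enum_mem size_filter.
by congr minn; exact: eq_count.
Qed.

Lemma slot_lt c l : l \in flatten [seq labels u | u <- c] -> slot c l < size c.
Proof.
by case/flatten_mapP => u uc lu; rewrite /slot -has_find; apply/hasP; exists u.
Qed.

Lemma mem_slot c l : l \in flatten [seq labels u | u <- c] ->
  l \in labels (nth Leaf c (slot c l)).
Proof.
move=> lc; apply: (nth_find Leaf (a := fun u => l \in labels u)).
by rewrite has_find; exact: slot_lt.
Qed.

Lemma mem_child c k l : k < size c -> l \in labels (nth Leaf c k) ->
  l \in flatten [seq labels u | u <- c].
Proof. by move=> kc lk; apply/flatten_mapP; exists (nth Leaf c k); rewrite ?mem_nth. Qed.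

Lemma slotE c k l : uniq (flatten [seq labels u | u <- c]) -> k < size c ->
  l \in labels (nth Leaf c k) -> slot c l = k.
Proof.
elim: c k => [//|u c IH] [_ _ lu|k]; rewrite /slot /= ?lu // cat_uniq.
case/and3P => _ /hasPn dis uc; rewrite ltnS => kc lk.
have -> : (l \in labels u) = false by exact/negbTE/dis/(mem_child kc lk).
by rewrite -(IH k).
Qed.

Lemma increasing_gt j c l : is_increasing s (Node j c) ->
  l \in flatten [seq labels u | u <- c] -> j < l.
Proof.
have H t : forall j, is_increasing s t -> root_gt j t -> l \in labels t -> j < l.
  elim/ptree_nested_ind: t => [//|i d IH] j' /= /and3P[_ /allP ri /allP si] ji.
  rewrite inE => /orP[/eqP -> //|/flatten_mapP[u ud lu]].
  apply: (ltn_trans ji); move: (ud); rewrite -(nth_index Leaf ud) => xd.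
  apply: (IH (index u d)); rewrite ?index_mem ?ri ?si ?nth_index //.
move=> /= /and3P[_ /allP rj /allP sj] /flatten_mapP[u uc lu].
by apply: (H u); rewrite ?rj ?sj.
Qed.

Lemma increasing_child j c k : is_increasing s (Node j c) ->
  k < size c -> is_increasing s (nth Leaf c k).
Proof. by case/and3P => _ _ /allP sj kc; apply/sj/mem_nth. Qed.

Lemma uniq_child c k : uniq (flatten [seq labels u | u <- c]) ->
  k < size c -> uniq (labels (nth Leaf c k)).
Proof.
elim: c k => [//|u c IH] [|k] /=; rewrite cat_uniq => /and3P[//] _ _.
by move=> uc kc; apply: IH.
Qed.

Lemma count_lt_iota k m : count (fun x => k < x) (iota 0 m) = m - k.+1.
Proof.
elim: m => // m IH; rewrite -(addn1 m) iotaD count_cat IH /= add0n addn0.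
by case: (ltnP k m); lia.
Qed.

Lemma addr_child j c l : l \in flatten [seq labels u | u <- c] -> j != l ->
  addr (Node j c) l = slot c l :: addr (nth Leaf c (slot c l)) l.
Proof.
move=> lc /negPf /= ->; rewrite -/(slot c l) (nth_map Leaf) //.
exact: slot_lt.
Qed.

Lemma pos_root j c l : is_increasing s (Node j c) ->
  l \in flatten [seq labels u | u <- c] -> pos s (Node j c) j l = s j - slot c l.
Proof.
move=> incr lc; have jl := increasing_gt incr lc.
have nejl : j != l by apply/negP => /eqP e; move: jl; rewrite e ltnn.
have aj : addr (Node j c) j = [::] by rewrite /= eqxx.
rewrite posE (addr_child lc nejl) aj (eq_count (a2 := fun x => slot c l < x)); last first.
  by move=> x /=; rewrite andbF orbF.
have /andP[/eqP sc _] := incr; have := slot_lt lc.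
by rewrite count_lt_iota; lia.
Qed.

Lemma pos_children j c i l : is_increasing s (Node j c) ->
  i \in flatten [seq labels u | u <- c] ->
  l \in flatten [seq labels u | u <- c] ->
  pos s (Node j c) i l =
    if slot c i == slot c l then pos s (nth Leaf c (slot c i)) i l
    else if slot c l < slot c i then s i else 0.
Proof.
move=> incr ic lc.
have ne k : k \in flatten [seq labels u | u <- c] -> j != k.
  by move=> kc; have := increasing_gt incr kc; case: eqP => // ->; rewrite ltnn.
rewrite !posE (addr_child ic (ne _ ic)) (addr_child lc (ne _ lc)).
case: eqVneq => [->|nil].
  by congr minn; apply: eq_count => x /=; rewrite ltnn eqxx.
rewrite (eq_count (a2 := fun=> slot c l < slot c i)); last first.
  by move=> x /=; rewrite (negPf nil) orbF.
case: ltnP => _; last by rewrite count_pred0 minn0.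
by rewrite count_predT size_iota; lia.
Qed.

Lemma pos_inj t u : is_increasing s t -> is_increasing s u ->
  uniq (labels t) -> uniq (labels u) -> labels t =i labels u ->
  (forall i j, i \in labels t -> j \in labels t -> i < j ->
     pos s t i j = pos s u i j) ->
  t = u.
Proof.
elim/ptree_nested_ind: t u => [|j c IH] [|i d] // it iu.
- by move=> _ _ /(_ i); rewrite !inE eqxx.
- by move=> _ _ /(_ j); rewrite !inE eqxx.
move=> ut uu eL eP.
have eij : i = j.
  apply/val_inj/eqP; rewrite eqn_leq; apply/andP; split.
    have := eL j; rewrite /= !inE eqxx /= => /esym /orP[/eqP-> //|].
    by move/(increasing_gt iu)/ltnW.
  have := eL i; rewrite /= !inE eqxx /= => /orP[/eqP-> //|].
  by move/(increasing_gt it)/ltnW.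
move: iu uu eL eP; rewrite {i}eij => iu uu eL eP.
have eF l : (l \in flatten [seq labels u | u <- c]) =
            (l \in flatten [seq labels u | u <- d]).
  have := eL l; rewrite /= !inE; case: eqVneq => // -> _.
  by move: ut uu => /= /andP[/negPf-> _] /andP[/negPf-> _].
have [/eqP sc _] := andP it; have [/eqP sd _] := andP iu.
have eS l : l \in flatten [seq labels u | u <- c] -> slot c l = slot d l.
  move=> lc; have ld : l \in flatten [seq labels u | u <- d] by rewrite -eF.
  have := eP j l; rewrite /= !inE eqxx lc orbT => /(_ isT isT).
  rewrite (increasing_gt it) // => /(_ isT).
  rewrite !pos_root // => e; have := slot_lt lc; have := slot_lt ld.
  by move: e; rewrite sc sd; lia.
have [_ uc] := andP ut; have [_ ud] := andP uu.
congr Node; apply: (@eq_from_nth _ Leaf); first by rewrite sc sd.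
move=> k kc; have kd : k < size d by rewrite sd -sc.
apply: IH => //; try exact: increasing_child it _; try exact: increasing_child iu _.
- exact: uniq_child.
- exact: uniq_child.
- move=> l; apply/idP/idP => lk.
    have lc := mem_child kc lk; have e := slotE uc kc lk.
    by have := mem_slot (c := d) (l := l); rewrite -eF -eS // e; apply.
  have ld := mem_child kd lk; have e := slotE ud kd lk.
  by have := mem_slot (c := c) (l := l); rewrite eF eS ?eF // e; apply.
- move=> i l ik lk il.
  have ic := mem_child kc ik; have lc := mem_child kc lk.
  have := eP i l; rewrite /= !inE ic lc !orbT => /(_ isT isT il).
  rewrite !pos_children -?eF // -!eS // !(slotE uc kc) //.
  by rewrite eqxx.
Qed.

(* The matrices [pos t] of the s-trees [t] are the ones satisfying
   [posmx_spec]; the lattice operations are computed on them. *)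
Definition posmx_spec (D : seq 'I_n) (m : 'I_n -> 'I_n -> nat) : Prop :=
  forall i j k, i \in D -> j \in D -> k \in D -> i < j -> j < k ->
    (0 < m j k -> m i j <= m i k) /\ (m j k < s j -> m i k <= m i j).

Lemma pos_posmx t : is_increasing s t -> uniq (labels t) ->
  posmx_spec (labels t) (pos s t).
Proof.
elim/ptree_nested_ind: t => [|r c IH] it ut i j k //.
rewrite !inE.
have [_ uc] := andP ut.
have gt l : l \in flatten [seq labels u | u <- c] -> r < l.
  exact: increasing_gt it.
move=> ii jj kk ij jk.
have ri : r <= i by move: ii => /orP[/eqP->|/gt /ltnW].
have jc : j \in flatten [seq labels u | u <- c].
  by move: jj => /orP[/eqP e|//]; move: ij; rewrite e ltnNge ri.
have kc : k \in flatten [seq labels u | u <- c].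
  move: kk => /orP[/eqP e|//]; move: (ltn_trans ij jk).
  by rewrite e ltnNge ri.
have sj := slot_lt jc; have sk := slot_lt kc.
move: ii => {jj kk} /orP[/eqP->|ic].
  rewrite !pos_root // pos_children //.
  case: eqVneq => [->|ne]; first by split.
  by case: (ltnP (slot c k) (slot c j)) => ?; split; lia.
have si := slot_lt ic.
rewrite !pos_children //.
have [eij|nij] := eqVneq (slot c i) (slot c j); last first.
  have [ejk|njk] := eqVneq (slot c j) (slot c k).
    by rewrite -ejk (negPf nij).
  have [eik|nik] := eqVneq (slot c i) (slot c k).
    have := pos_le (nth Leaf c (slot c i)) i k => ?.
    rewrite -eik; case: (ltnP (slot c j) (slot c i)) => ?;
      by case: (ltnP (slot c i) (slot c j)) => ?; split; lia.
  case: (ltnP (slot c j) (slot c i)) => ?; case: (ltnP (slot c k) (slot c j)) => ?;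
    by case: (ltnP (slot c k) (slot c i)) => ?; split; lia.
rewrite -eij; have [eik|nik] := eqVneq (slot c i) (slot c k).
  apply: (IH _ si) => //; first exact: increasing_child it _.
  - exact: uniq_child.
  - exact: mem_slot.
  - by rewrite eij; exact: mem_slot.
  - by rewrite eik; exact: mem_slot.
have := pos_le (nth Leaf c (slot c i)) i j => ?.
by case: (ltnP (slot c k) (slot c i)) => ?; split; lia.
Qed.

Fixpoint tree_of_posmx (m : 'I_n -> 'I_n -> nat) (f : nat) (J : seq 'I_n) :=
  match f, J with
  | f'.+1, j :: J' =>
      Node j [seq tree_of_posmx m f' [seq l <- J' | s j - m j l == k]
             | k <- iota 0 (s j).+1]
  | _, _ => Leaf
  end.

Lemma tree_of_posmxE m f j J : tree_of_posmx m f.+1 (j :: J) =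
  Node j [seq tree_of_posmx m f [seq l <- J | s j - m j l == k]
         | k <- iota 0 (s j).+1].
Proof. by []. Qed.

Lemma is_increasingE j c : is_increasing s (Node j c) =
  [&& size c == (s j).+1, all (root_gt j) c & all (is_increasing s) c].
Proof. by []. Qed.

Lemma perm_flatten_fibers (T : eqType) (g : T -> nat) m (J : seq T) :
  all (fun x => g x < m) J ->
  perm_eq (flatten [seq [seq x <- J | g x == k] | k <- iota 0 m]) J.
Proof.
have H p : perm_eq (flatten [seq [seq x <- J | g x == k] | k <- iota 0 p])
                   [seq x <- J | g x < p].
  elim: p => [|p IH]; first by rewrite /= (eq_filter (a2 := pred0)) ?filter_pred0.
  rewrite -(addn1 p) iotaD map_cat flatten_cat /= cats0 add0n addn1.
  apply: (@perm_trans _ ([seq x <- J | g x < p] ++ [seq x <- J | g x == p])).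
    by rewrite perm_cat2r.
  rewrite perm_sym -(perm_filterC (fun x => g x < p)) -!filter_predI.
  rewrite (eq_filter (a2 := fun x => g x < p)); last by move=> x /=; lia.
  by rewrite perm_cat2l (eq_filter (a2 := fun x => g x == p)) // => x /=; lia.
by move=> /all_filterP a; rewrite -{2}a.
Qed.

Lemma perm_flatten_map (T U : eqType) (F G : T -> seq U) r :
  (forall k, k \in r -> perm_eq (F k) (G k)) ->
  perm_eq (flatten (map F r)) (flatten (map G r)).
Proof.
elim: r => //= x r IH H; rewrite perm_cat ?H ?mem_head // IH // => k kr.
by rewrite H // inE kr orbT.
Qed.

Definition label_lt : rel 'I_n := fun i j => i < j.

Lemma label_lt_trans : transitive label_lt.
Proof. by move=> ? ? ?; exact: ltn_trans. Qed.

Lemma tree_of_posmx_labels m f J : size J <= f ->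
  perm_eq (labels (tree_of_posmx m f J)) J.
Proof.
elim: f J => [[]//|f IH [//|j J]] /=; rewrite ltnS => sJ.
rewrite perm_cons -map_comp.
apply: (@perm_trans _
  (flatten [seq [seq l <- J | s j - m j l == k] | k <- iota 0 (s j).+1])).
  apply: perm_flatten_map => k _ /=; apply: IH.
  by rewrite size_filter (leq_trans (count_size _ _)).
by apply: perm_flatten_fibers; apply/allP => x _; lia.
Qed.

Lemma tree_of_posmx_incr m f J : size J <= f -> sorted label_lt J ->
  is_increasing s (tree_of_posmx m f J).
Proof.
elim: f J => [[]//|f IH [//|j J]]; rewrite [size _]/= ltnS => sJ sortJ.
have sF k : size [seq l <- J | s j - m j l == k] <= f.
  by rewrite size_filter (leq_trans (count_size _ _)).
rewrite tree_of_posmxE is_increasingE size_map size_iota eqxx andTb; apply/andP; split; apply/allP => u /mapP[k _ ->].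
  move: (sF k) (mem_filter (fun l => s j - m j l == k)^~ J).
  case: f {IH sJ} sF => [|f] sF; case E: [seq l <- J | _] => [//|a F] // _ _.
  have : a \in J.
    have : a \in [seq l <- J | s j - m j l == k] by rewrite E mem_head.
    by rewrite mem_filter => /andP[].
  by move/(order_path_min label_lt_trans)/allP: sortJ; apply.
apply: IH => //; apply: sorted_filter; first exact: label_lt_trans.
exact: path_sorted sortJ.
Qed.

Lemma tree_of_posmx_pos m f J : size J <= f -> sorted label_lt J ->
  (forall i j, i < j -> m i j <= s i) -> posmx_spec J m ->
  {in J &, forall i l, i < l -> pos s (tree_of_posmx m f J) i l = m i l}.
Proof.
elim: f J => [[]//|f IH [//|j J]]; rewrite [size _]/= ltnS => sJ sortJ ms mJ.
have incr := tree_of_posmx_incr m (f := f.+1) (J := j :: J) sJ sortJ.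
have perm := tree_of_posmx_labels m (f := f.+1) (J := j :: J) sJ.
have sortJ' := path_sorted sortJ.
have ltJ l : l \in J -> j < l.
  by move/(order_path_min label_lt_trans)/allP: sortJ; apply.
have uJ : uniq (j :: J).
  by apply: sorted_uniq sortJ; [exact: label_lt_trans|move=> x; apply: ltnn].
move: incr perm; rewrite tree_of_posmxE.
set c := (X in Node j X) => incr perm i l.
have sc : size c = (s j).+1 by rewrite size_map size_iota.
have cE k : k < (s j).+1 ->
    nth Leaf c k = tree_of_posmx m f [seq l <- J | s j - m j l == k].
  by move=> ks; rewrite (nth_map 0) ?size_iota // nth_iota.
have sF k : size [seq l <- J | s j - m j l == k] <= f.
  by rewrite size_filter (leq_trans (count_size _ _)).
have uc : uniq (flatten [seq labels u | u <- c]).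
  by have := perm_uniq perm; rewrite uJ => /andP[].
have memc x : (x \in flatten [seq labels u | u <- c]) = (x \in J).
  by move: perm => /=; rewrite perm_cons => /perm_mem ->.
have slotc x : x \in J -> slot c x = s j - m j x.
  move=> xJ; apply: slotE => //; first by rewrite sc; lia.
  rewrite cE; last by lia.
  by rewrite (perm_mem (tree_of_posmx_labels m (sF _))) mem_filter eqxx.
rewrite 2!inE => /orP[/eqP-> {i}|iJ] /orP[/eqP-> {l}|lJ]; first by rewrite ltnn.
- by move=> jl; rewrite pos_root ?memc // slotc //; have := ms j l jl; lia.
- by move=> ij; have := ltJ _ iJ; lia.
move=> il; rewrite pos_children ?memc // !slotc //.
have ji := ltJ _ iJ; have jl := ltJ _ lJ.
have mji := ms _ _ ji; have mjl := ms _ _ jl; have mil := ms _ _ il.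
have inJ x : x \in J -> x \in j :: J by move=> xJ; rewrite !inE xJ orbT.
have [m1 m2] := mJ j i l (mem_head j J) (inJ i iJ) (inJ l lJ) ji il.
case: eqVneq => [e|ne]; last first.
  case: ltnP => h.
    by case: (ltnP (m i l) (s i)) => [/m2|]; lia.
  by case: (posnP (m i l)) => [->//|/m1]; lia.
rewrite cE; last by lia.
apply: IH => //.
- by apply: sorted_filter; first exact: label_lt_trans.
- move=> x y z; rewrite !mem_filter => /andP[_ xJ] /andP[_ yJ] /andP[_ zJ].
  by apply: mJ; exact: inJ.
- by rewrite mem_filter eqxx.
- by rewrite mem_filter e eqxx.
Qed.

Lemma sorted_enum_label (A : {pred 'I_n}) : sorted label_lt (enum A).
Proof.
rewrite /enum_mem; apply: sorted_filter; first exact: label_lt_trans.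
rewrite -enumT; have := iota_ltn_sorted 0 n; rewrite -val_enum_ord.
by rewrite sorted_map.
Qed.

(* [n] units of fuel suffice, as the length [k - i] decreases. *)
Fixpoint join_posmx_fuel (f : nat) (p q : 'I_n -> 'I_n -> nat) (i k : 'I_n) :=
  maxn (maxn (p i k) (q i k))
    (if f is f'.+1 then
       \max_(j : 'I_n | [&& i < j, j < k & 0 < join_posmx_fuel f' p q j k])
          join_posmx_fuel f' p q i j
     else 0).

Definition join_posmx := join_posmx_fuel n.

Definition opp_posmx (p : 'I_n -> 'I_n -> nat) (i j : 'I_n) := s i - p i j.

Definition meet_posmx p q :=
  opp_posmx (join_posmx (opp_posmx p) (opp_posmx q)).

Lemma join_posmx_stable p q f g (i k : 'I_n) : k - i <= f -> k - i <= g ->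
  join_posmx_fuel f p q i k = join_posmx_fuel g p q i k.
Proof.
elim: f g i k => [|f IH] [|g] i k //=; rewrite ?maxn0 => kf kg.
- by rewrite big1 ?maxn0 // => j; lia.
- by rewrite big1 ?maxn0 // => j; lia.
congr maxn; apply: eq_big => [j|j /and3P[ij jk _]]; last by apply: IH; lia.
case: (ltnP i j) => //= ij; case: (ltnP j k) => //= jk.
by rewrite (IH g) //; lia.
Qed.

Lemma join_posmxE p q i k : join_posmx p q i k =
  maxn (maxn (p i k) (q i k))
    (\max_(j : 'I_n | [&& i < j, j < k & 0 < join_posmx p q j k])
        join_posmx p q i j).
Proof.
rewrite {1}/join_posmx (@join_posmx_stable _ _ _ n.+1) //=; last first.
- by have := ltn_ord k; lia.
- by have := ltn_ord k; lia.
Qed.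

Lemma join_posmx_gel p q i k : p i k <= join_posmx p q i k.
Proof. by rewrite join_posmxE -maxnA leq_maxl. Qed.

Lemma join_posmx_ger p q i k : q i k <= join_posmx p q i k.
Proof. by rewrite join_posmxE (maxnC (p i k)) -maxnA leq_maxl. Qed.

Lemma join_posmx_mono p q i j (k : 'I_n) : i < j -> j < k -> 0 < join_posmx p q j k ->
  join_posmx p q i j <= join_posmx p q i k.
Proof.
move=> ij jk jk0; rewrite [leqRHS]join_posmxE leq_max; apply/orP; right.
by apply: leq_bigmax_cond; rewrite ij jk.
Qed.

Lemma join_posmx_lub p q m :
  (forall i j, i < j -> p i j <= m i j) ->
  (forall i j, i < j -> q i j <= m i j) ->
  (forall i j (k : 'I_n), i < j -> j < k -> 0 < m j k -> m i j <= m i k) ->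
  forall i (k : 'I_n), i < k -> join_posmx p q i k <= m i k.
Proof.
move=> pm qm mm i k; have [N] := ubnP (k - i); elim: N i k => // N IH i k kiN ik.
rewrite join_posmxE !geq_max pm ?qm //=; apply/bigmax_leqP => j /and3P[ij jk].
move=> jk0; apply: (leq_trans (IH i j _ ij)); first by lia.
by apply: mm => //; apply: (leq_trans jk0); apply: IH => //; lia.
Qed.

Lemma join_posmx_le p q :
  (forall i j, i < j -> p i j <= s i) -> (forall i j, i < j -> q i j <= s i) ->
  forall i j, i < j -> join_posmx p q i j <= s i.
Proof. by move=> ps qs; apply: (join_posmx_lub (m := fun i _ => s i)). Qed.

Lemma join_posmx_spec p q :
  (forall i j, i < j -> p i j <= s i) -> (forall i j, i < j -> q i j <= s i) ->
  posmx_spec (enum 'I_n) p -> posmx_spec (enum 'I_n) q -> posmx_spec (enum 'I_n) (join_posmx p q).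
Proof.
move=> ps qs pP qP; set m := join_posmx p q.
have ms := join_posmx_le ps qs : forall i j, i < j -> m i j <= s i.
suff H : forall i j (k : 'I_n), i < j -> j < k -> m i j < m i k -> m j k = s j.
  move=> i j k _ _ _ ij jk; split; first exact: join_posmx_mono.
  by move=> mjk; rewrite leqNgt; apply/negP => /(H _ _ _ ij jk) e; lia.
move=> i j k; have [N] := ubnP (k - i); elim: N i j k => // N IH i j k kiN ij jk.
have full (h : 'I_n -> 'I_n -> nat) : posmx_spec (enum 'I_n) h ->
    (forall x y, h x y <= m x y) -> m i j < h i k -> m j k = s j.
  move=> hP hm mh; apply/eqP; rewrite eqn_leq ms //= leqNgt; apply/negP => lt.
  have [_ h2] := hP i j k (mem_enum _ _) (mem_enum _ _) (mem_enum _ _) ij jk.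
  by have := h2 (leq_ltn_trans (hm j k) lt); have := hm i j; lia.
rewrite {2}/m join_posmxE !leq_max -orbA => /or3P[| |mlt].
- by apply: full => // x y; exact: join_posmx_gel.
- by apply: full => // x y; exact: join_posmx_ger.
have [l [il lk lk0 lj]] : exists l, [/\ i < l, l < k, 0 < m l k & m i j < m i l].
  have [/existsP[l /and4P[]]|/existsPn none] :=
    boolP [exists l : 'I_n, [&& i < l, l < k, 0 < m l k & m i j < m i l]].
    by exists l.
  suff : \max_(l : 'I_n | [&& i < l, l < k & 0 < m l k]) m i l <= m i j.
    by move: mlt; rewrite -/m; lia.
  apply/bigmax_leqP => l /and3P[il lk lk0].
  by rewrite leqNgt; have := none l; rewrite il lk lk0.
case: (ltngtP l j) => [l_lt_j|j_lt_l|/val_inj e]; last by move: lj; rewrite e ltnn.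
  apply: (IH l); [lia|lia|lia|].
  case: (posnP (m l j)) => [-> //|/(join_posmx_mono il l_lt_j)].
  by rewrite -/m; lia.
have e : m j l = s j by apply: (IH i) => //; lia.
apply/eqP; rewrite eqn_leq ms //= -e.
exact: join_posmx_mono.
Qed.

Lemma opp_posmx_spec p : (forall i j, i < j -> p i j <= s i) ->
  posmx_spec (enum 'I_n) p -> posmx_spec (enum 'I_n) (opp_posmx p).
Proof.
move=> ps pP i j k iE jE kE ij jk; rewrite /opp_posmx.
have [p1 p2] := pP i j k iE jE kE ij jk.
have := ps i j ij; have := ps j k jk; have := ps i k (ltn_trans ij jk) => ? ? ?.
split=> h.
  by have := p2 ltac:(lia); lia.
by have := p1 ltac:(lia); lia.
Qed.

Lemma tree_of_posmx_stree m : is_stree s (tree_of_posmx m n (enum 'I_n)).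
Proof.
have sE : size (enum 'I_n) <= n by rewrite size_enum_ord.
by rewrite /is_stree tree_of_posmx_incr ?sorted_enum_label ?tree_of_posmx_labels.
Qed.

Definition stree_of_posmx m : stree s := STree (tree_of_posmx_stree m).

Lemma stree_of_posmxE m : (forall i j, i < j -> m i j <= s i) ->
  posmx_spec (enum 'I_n) m ->
  forall i j, i < j -> pos s (stree_val (stree_of_posmx m)) i j = m i j.
Proof.
move=> ms mP i j ij; apply: tree_of_posmx_pos; rewrite ?mem_enum //.
  by rewrite size_enum_ord.
exact: sorted_enum_label.
Qed.

Lemma stree_pos_spec (T : stree s) : posmx_spec (enum 'I_n) (pos s (stree_val T)).
Proof.
have /andP[Ti Tl] := stree_valP T; have Tm := perm_mem Tl.
move=> i j k iE jE kE; apply: (pos_posmx Ti); rewrite ?Tm //.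
by rewrite (perm_uniq Tl) enum_uniq.
Qed.
End Pos.

Section WeakOrder.
Variables (n : nat) (s : 'I_n -> nat).
Implicit Types T : stree s.

Definition stree_le (T T' : stree s) : bool :=
  [forall i : 'I_n, forall j : 'I_n,
     (i < j) ==> (pos s (stree_val T) i j <= pos s (stree_val T') i j)].

Lemma stree_leP T T' : reflect
  (forall i j : 'I_n, i < j -> pos s (stree_val T) i j <= pos s (stree_val T') i j)
  (stree_le T T').
Proof.
apply: (iffP forallP) => [h i j|h i]; last by apply/forallP => j; apply/implyP/h.
by have /forallP/(_ j)/implyP := h i.
Qed.

Lemma stree_le_refl : reflexive stree_le.
Proof. by move=> T; apply/stree_leP. Qed.

Lemma stree_le_trans : transitive stree_le.
Proof.
move=> U T V /stree_leP TU /stree_leP UV; apply/stree_leP => i j ij.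
exact: leq_trans (TU i j ij) (UV i j ij).
Qed.

Lemma stree_le_anti : antisymmetric stree_le.
Proof.
move=> T U /andP[/stree_leP TU /stree_leP UT]; apply/val_inj.
have /andP[Ti Tl] := stree_valP T; have /andP[Ui Ul] := stree_valP U.
apply: (pos_inj Ti Ui).
- by rewrite (perm_uniq Tl) enum_uniq.
- by rewrite (perm_uniq Ul) enum_uniq.
- by move=> i; rewrite (perm_mem Tl) (perm_mem Ul).
- by move=> i j _ _ ij; apply/eqP; rewrite eqn_leq TU ?UT.
Qed.

Definition stree_join (T U : stree s) : stree s := stree_of_posmx s
  (join_posmx (pos s (stree_val T)) (pos s (stree_val U))).

Definition stree_meet (T U : stree s) : stree s := stree_of_posmx s
  (meet_posmx s (pos s (stree_val T)) (pos s (stree_val U))).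

Lemma stree_joinE T U (i j : 'I_n) : i < j -> pos s (stree_val (stree_join T U)) i j =
  join_posmx (pos s (stree_val T)) (pos s (stree_val U)) i j.
Proof.
apply: stree_of_posmxE.
  by apply: join_posmx_le => *; exact: pos_le.
by apply: join_posmx_spec => [*|*||]; rewrite ?pos_le //; exact: stree_pos_spec.
Qed.

Lemma stree_meetE T U (i j : 'I_n) : i < j -> pos s (stree_val (stree_meet T U)) i j =
  meet_posmx s (pos s (stree_val T)) (pos s (stree_val U)) i j.
Proof.
have opp_le p (a b : 'I_n) : a < b -> opp_posmx s p a b <= s a.
  by move=> _; exact: leq_subr.
apply: stree_of_posmxE; first exact: opp_le.
apply: opp_posmx_spec; first by apply: join_posmx_le; exact: opp_le.
apply: join_posmx_spec; try exact: opp_le;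
  by apply: opp_posmx_spec => [*|]; rewrite ?pos_le //; exact: stree_pos_spec.
Qed.

Lemma stree_leUx T U V :
  stree_le (stree_join T U) V = stree_le T V && stree_le U V.
Proof.
apply/stree_leP/andP => [h|[/stree_leP TV /stree_leP UV] i j ij].
  split; apply/stree_leP => i j ij; apply: leq_trans (h i j ij).
    by rewrite stree_joinE ?join_posmx_gel.
  by rewrite stree_joinE ?join_posmx_ger.
rewrite stree_joinE //.
apply: (join_posmx_lub (m := pos s (stree_val V))) => // a b c ab bc.
by case: (@stree_pos_spec _ _ V a b c); rewrite ?mem_enum.
Qed.

Lemma stree_lexI T U V :
  stree_le T (stree_meet U V) = stree_le T U && stree_le T V.
Proof.
apply/stree_leP/andP => [h|[/stree_leP TU /stree_leP TV] i j ij].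
  split; apply/stree_leP => i j ij; apply: leq_trans (h i j ij) _;
    rewrite stree_meetE // /meet_posmx {1}/opp_posmx.
    have := join_posmx_gel (opp_posmx s (pos s (stree_val U)))
      (opp_posmx s (pos s (stree_val V))) i j.
    by rewrite {1}/opp_posmx; have := pos_le s (stree_val U) i j; lia.
  have := join_posmx_ger (opp_posmx s (pos s (stree_val U)))
    (opp_posmx s (pos s (stree_val V))) i j.
  by rewrite {1}/opp_posmx; have := pos_le s (stree_val V) i j; lia.
rewrite stree_meetE // /meet_posmx {1}/opp_posmx.
set o := opp_posmx s (pos s (stree_val T)).
suff : join_posmx (opp_posmx s (pos s (stree_val U)))
         (opp_posmx s (pos s (stree_val V))) i j <= o i j.
  have -> : o i j = s i - pos s (stree_val T) i j by [].
  by have := pos_le s (stree_val T) i j; lia.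
apply: join_posmx_lub => // [a b ab|a b ab|a b c ab bc].
- by apply: leq_sub2l; exact: TU.
- by apply: leq_sub2l; exact: TV.
have oP : posmx_spec s (enum 'I_n) o.
  by apply: opp_posmx_spec => [*|]; rewrite ?pos_le //; exact: stree_pos_spec.
by case: (oP a b c); rewrite ?mem_enum.
Qed.

(* From here on [<=], [`|`] and [`&`] on [stree s] are those of the s-weak
   order. *)
Fact stree_display : Order.disp_t. Proof. exact: Order.Disp tt tt. Qed.

HB.instance Definition _ := Order.Le_isPOrder.Build stree_display (stree s)
  stree_le_refl stree_le_anti stree_le_trans.
HB.instance Definition _ := Order.POrder_MeetJoin_isLattice.Build
  stree_display (stree s) stree_lexI stree_leUx.
End WeakOrder.

Section Congruences.
Context {d : Order.disp_t} {L : latticeType d}.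
Local Open Scope order_scope.
Implicit Types (x y z : L) (R : L -> L -> Prop).

Definition lattice_congruence R : Prop :=
  [/\ forall x, R x x,
      forall x y, R x y -> R y x,
      forall x y z, R x y -> R y z -> R x z &
      forall x x' y y', R x x' -> R y y' ->
        R (x `|` y) (x' `|` y') /\ R (x `&` y) (x' `&` y')].

Definition covers x y : Prop := y < x /\ forall z, ~~ (y < z < x).

Definition unique_lower_cover x y : Prop := forall z, covers x z <-> z = y.

(* Only meant for a join irreducible [x]: false when [x] does not cover a
   unique element. *)
Definition contracted R x : Prop :=
  exists2 y, unique_lower_cover x y & R x y.

Definition forces x x' : Prop :=
  forall R, lattice_congruence R -> contracted R x -> contracted R x'.
End Congruences.

Record sarc n (s : 'I_n -> nat) : Type := SArc {
  arc_i : 'I_n;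
  arc_j : 'I_n;
  arc_A : {set 'I_n};
  arc_B : {set 'I_n};
  arc_r : nat;
  arc_ij : arc_i < arc_j;
  arc_AB : [disjoint arc_A & arc_B];
  arc_ABE : arc_A :|: arc_B = [set k : 'I_n | (arc_i < k < arc_j) && (s k != 0)];
  arc_r_range : 1 <= arc_r <= s arc_i
}.

Definition subarc n (s : 'I_n -> nat) (a a' : sarc s) : Prop :=
  [/\ arc_i a' <= arc_i a /\ arc_j a <= arc_j a',
      arc_A a \subset arc_A a' /\ arc_B a \subset arc_B a',
      s (arc_j a) = 0 -> arc_j a = arc_j a',
      arc_i a' = arc_i a -> arc_r a = arc_r a' &
      arc_i a' < arc_i a ->
        (arc_i a \in arc_A a' /\ arc_r a = 1) \/
        (arc_i a \in arc_B a' /\ arc_r a = s (arc_i a))].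

Fixpoint right_comb n (s : 'I_n -> nat) (J : seq 'I_n) : ptree n :=
  if J is j :: J' then Node j (rcons (nseq (s j) Leaf) (right_comb s J'))
  else Leaf.

(* [replace_edge t i k u] hangs [u] from the edge of rank [k], from the left
   and from 0, of the node [i] of [t], discarding what was there. *)
Fixpoint replace_edge n (t : ptree n) (i : 'I_n) (k : nat) (u : ptree n) :=
  if t is Node j c then
    Node j (if j == i then set_nth Leaf c k u
            else [seq replace_edge v i k u | v <- c])
  else Leaf.

(* The (r+1)-st edge from the right among s_i + 1 has rank s_i - r from the
   left; [enum] lists a set of labels in increasing order. *)
Definition arc_ptree n (s : 'I_n -> nat) (a : sarc s) : ptree n :=
  replace_edge (right_comb s (enum (~: (arc_j a |: arc_A a))))
    (arc_i a) (s (arc_i a) - arc_r a)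
    (right_comb s (enum (arc_j a |: arc_A a))).

Section ArcTree.
Variables (n : nat) (s : 'I_n -> nat).
Implicit Types (i j : 'I_n) (J : seq 'I_n) (u : ptree n).

Lemma flatten_labels_nseq m : flatten [seq labels v | v <- nseq m (@Leaf n)] = [::].
Proof. by elim: m. Qed.

Lemma right_comb_labels J : labels (right_comb s J) = J.
Proof.
elim: J => //= j J IH.
by rewrite map_rcons flatten_rcons flatten_labels_nseq IH.
Qed.

Lemma right_comb_root j J : all (label_lt j) J -> root_gt j (right_comb s J).
Proof. by case: J => //= i J /andP[]. Qed.

Lemma right_comb_incr J : sorted (@label_lt n) J -> is_increasing s (right_comb s J).
Proof.
elim: J => // j J IH jJ; rewrite /= size_rcons size_nseq eqxx /= !all_rcons.
rewrite right_comb_root ?(order_path_min (@label_lt_trans n) jJ) //.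
by rewrite IH ?(path_sorted jJ) // !all_nseq !orbT.
Qed.

Lemma all_set_nth_leaf (P : pred (ptree n)) c k u :
  k < size c -> all P c -> P u -> all P (set_nth Leaf c k u).
Proof.
elim: c k => [//|v c IH] [|k] /= kc /andP[Pv Pc] Pu; rewrite ?Pu ?Pv ?Pc //=.
exact: IH.
Qed.

Lemma flatten_set_nth_leaf c k u : k < size c -> nth Leaf c k = Leaf ->
  perm_eq (flatten [seq labels v | v <- set_nth Leaf c k u])
          (flatten [seq labels v | v <- c] ++ labels u).
Proof.
elim: c k => [//|v c IH] [|k] /= kc => [->|ck]; first by rewrite perm_catC.
by rewrite -catA perm_cat2l IH.
Qed.

Lemma replace_edge_comb J i k u : sorted (@label_lt n) J -> i \in J -> k < s i ->
  is_increasing s u -> root_gt i u ->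
  let t := replace_edge (right_comb s J) i k u in
  [/\ is_increasing s t, perm_eq (labels t) (J ++ labels u) &
      forall j, root_gt j (right_comb s J) -> root_gt j t].
Proof.
move=> sJ iJ ki iu ru; elim: J sJ iJ => [//|j J IH] jJ.
have /andP[_ /andP[rj ij]] := right_comb_incr jJ.
have sz : size (rcons (nseq (s j) Leaf) (right_comb s J)) = (s j).+1.
  by rewrite size_rcons size_nseq.
rewrite inE => /orP[/eqP ij'|iJ].
  move: rj ij sz; rewrite -{j}ij' in jJ * => rj ij sz t.
  have -> : t = Node i
      (set_nth Leaf (rcons (nseq (s i) Leaf) (right_comb s J)) k u).
    by rewrite /t /= eqxx.
  have ksz : k < size (rcons (nseq (s i) Leaf) (right_comb s J)).
    by rewrite sz ltnS ltnW.
  split=> [||l] //.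
    rewrite is_increasingE size_set_nth sz.
    by rewrite (maxn_idPr _) ?eqxx ?all_set_nth_leaf // ltnS ltnW.
  rewrite /= perm_cons; apply: perm_trans (flatten_set_nth_leaf _ ksz _) _.
    by rewrite nth_rcons size_nseq ki nth_nseq ki.
  by rewrite map_rcons flatten_rcons flatten_labels_nseq right_comb_labels.
have nji : (j == i) = false.
  apply/eqP => e; have /allP/(_ i iJ) := order_path_min (@label_lt_trans n) jJ.
  by rewrite /label_lt e ltnn.
have [] := IH (path_sorted jJ) iJ; move: rj ij; rewrite !all_rcons.
move=> /andP[rj _] /andP[ij _] it pt rt t.
have -> : t = Node j (rcons (nseq (s j) Leaf)
                            (replace_edge (right_comb s J) i k u)).
  by rewrite /t /= nji map_rcons map_nseq.
split=> [||l] //.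
  rewrite is_increasingE size_rcons size_nseq eqxx !all_rcons it rt //=.
  by rewrite !all_nseq !orbT.
by rewrite /= map_rcons flatten_rcons flatten_labels_nseq perm_cons.
Qed.

Lemma arc_ptree_stree (a : sarc s) : is_stree s (arc_ptree a).
Proof.
case: a => i j A B r ij AB ABE r_range; rewrite /arc_ptree /=.
have /andP[r0 rs] := r_range.
have gt l : l \in j |: A -> i < l.
  rewrite !inE => /orP[/eqP-> //|lA].
  by move/setP/(_ l): ABE; rewrite !inE lA => /esym /andP[/andP[]].
have iC : i \in enum (~: (j |: A)).
  by rewrite mem_enum inE; apply/negP => /gt; rewrite ltnn.
have [] := @replace_edge_comb (enum (~: (j |: A))) i (s i - r)
  (right_comb s (enum (j |: A))).
- exact: sorted_enum_label.
- exact: iC.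
- by lia.
- exact/right_comb_incr/sorted_enum_label.
- by apply/right_comb_root/allP => l; rewrite mem_enum; exact: gt.
rewrite right_comb_labels => it pt _; rewrite /is_stree it /=.
apply: perm_trans pt _; apply: uniq_perm; rewrite ?enum_uniq //.
  rewrite cat_uniq !enum_uniq andbT; apply/hasPn => l; rewrite !mem_enum.
  by rewrite in_setC => ->.
by move=> l; rewrite mem_cat !mem_enum in_setC orNb.
Qed.
End ArcTree.

Definition arc_stree n (s : 'I_n -> nat) (a : sarc s) : stree s :=
  STree (arc_ptree_stree a).

(* Main.v *)
(* Subtracting position matrices from [s] is an anti-automorphism of the s-weak
   order; it carries the join irreducible of the dual arc (exchange A and B,
   replace r by s_i + 1 - r) to the meet irreducible M(a) of the arc a, and it
   preserves subarcs.  Write J_* and M^* for the unique covers of J and M.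

   If a is a subarc of b whose start is that of b or lies in A_b and whose end
   is that of b or lies in B_b, then J_*(a) <= M(b) while J(a) is not below
   M(b), so a congruence contracting J(a) contracts [M(b), M^*(b)].  With a = b
   and duality this makes the contractions of J(a) and M(a) equivalent, and
   any subarc is reached in two steps, moving one endpoint at a time.

   Conversely, identify two trees when the same J(c), c a subarc of b, lie below
   them.  This relation is clearly compatible with meets.  It is also the
   relation of lying below the same M(c), because T is not below M(c) exactly
   when J(c') <= T for some subarc c' of c of a suitable shape; hence it is
   compatible with joins.  This congruence contracts J(a) unless a is a subarc
   of b, and it does not contract J(b). *)

Require Import Defs.
From mathcomp Require Import all_boot all_order.
From mathcomp Require Import zify.

Set Implicit Arguments.
Unset Strict Implicit.
Unset Printing Implicit Defensive.

Import Order.TTheory.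

(** * Contracted covers *)

Section CongruenceFacts.
Context {d : Order.disp_t} {L : latticeType d}.
Local Open Scope order_scope.
Implicit Types (x y z m : L) (R : L -> L -> Prop).

Lemma congruence_up R x x' m m' : lattice_congruence R ->
  x' <= m -> ~~ (x <= m) -> m <= m' -> (forall z, m < z -> m' <= z) ->
  R x x' -> R m' m.
Proof.
move=> [Rr _ _ Rc] x'm xm mm' mz Rxx'.
have [+ _] := Rc _ _ _ _ Rxx' (Rr m); rewrite (join_r x'm) => Rj.
have m'j : m' <= x `|` m.
  by apply: mz; rewrite lt_neqAle leUr andbT eq_sym -leEjoin.
by have [_] := Rc _ _ _ _ (Rr m') Rj; rewrite (meet_l m'j) (meet_r mm').
Qed.

Lemma lower_coverP x x' : x' < x -> (forall z, z < x -> z <= x') ->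
  unique_lower_cover x x'.
Proof.
move=> x'x zx' z; split=> [[zx nz]|->]; last first.
  split=> // w; apply/negP => /andP[x'w wx].
  by have := lt_le_trans x'w (zx' _ wx); rewrite ltxx.
have := nz x'; rewrite x'x andbT lt_neqAle zx' // andbT negbK.
by move/eqP.
Qed.

Lemma contractedE R x x' : unique_lower_cover x x' -> contracted R x <-> R x x'.
Proof.
move=> cx; split=> [[y cy Rxy]|]; last by exists x'.
by have <- : y = x' by apply/cx/cy.
Qed.
End CongruenceFacts.

Section Forcing.
Variables (n : nat) (s : 'I_n -> nat).
Implicit Types (a b : sarc s) (T U V : stree s) (x y z i j l p q u v : 'I_n).

Local Notation ps T := (pos s (stree_val T)).

Lemma sleP T U : reflect (forall i j, i < j -> ps T i j <= ps U i j) (T <= U)%O.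
Proof. exact: stree_leP. Qed.

Lemma stree_pos_inj T U : (forall i j, i < j -> ps T i j = ps U i j) -> T = U.
Proof.
by move=> e; apply/le_anti/andP; split; apply/sleP => i j ij; rewrite e.
Qed.

Lemma pos_cotrans T i j (k : 'I_n) : i < j -> j < k -> ps T j k < s j -> ps T i k <= ps T i j.
Proof. by move=> ij jk; case: (@stree_pos_spec _ _ T i j k); rewrite ?mem_enum. Qed.

(** * Duality *)

Definition opp_stree T : stree s := stree_of_posmx s (opp_posmx s (ps T)).

Lemma opp_streeE T i j : i < j -> ps (opp_stree T) i j = s i - ps T i j.
Proof.
apply: stree_of_posmxE => [{}i {}j _|]; first exact: leq_subr.
by apply: opp_posmx_spec => [*|]; [exact: pos_le | exact: stree_pos_spec].
Qed.

Lemma opp_streeK : involutive opp_stree.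
Proof.
move=> T; apply: stree_pos_inj => i j ij; rewrite !opp_streeE // subKn //.
exact: pos_le.
Qed.

Lemma opp_stree_le T U : (opp_stree T <= opp_stree U)%O = (U <= T)%O.
Proof.
apply/sleP/sleP => h i j ij; have := h i j ij; rewrite !opp_streeE //; last lia.
by have := pos_le s (stree_val U) i j; lia.
Qed.

Lemma opp_stree_le_swap T U : (opp_stree T <= U)%O = (opp_stree U <= T)%O.
Proof. by rewrite -{1}(opp_streeK U) opp_stree_le. Qed.

Lemma le_opp_stree_swap T U : (T <= opp_stree U)%O = (U <= opp_stree T)%O.
Proof. by rewrite -{1}(opp_streeK T) opp_stree_le. Qed.

Lemma opp_stree_join T U :
  opp_stree (T `|` U)%O = (opp_stree T `&` opp_stree U)%O.
Proof.
apply/le_anti; rewrite lexI !opp_stree_le leUl leUr /=.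
by rewrite le_opp_stree_swap leUx !(le_opp_stree_swap _ (_ `&` _)%O) leIl leIr.
Qed.

Lemma opp_stree_meet T U :
  opp_stree (T `&` U)%O = (opp_stree T `|` opp_stree U)%O.
Proof. by rewrite -[RHS]opp_streeK opp_stree_join !opp_streeK. Qed.

Definition opp_rel (R : stree s -> stree s -> Prop) T U :=
  R (opp_stree T) (opp_stree U).

Lemma opp_rel_congruence R : lattice_congruence R -> lattice_congruence (opp_rel R).
Proof.
move=> [Rr Rs Rt Rc]; split=> [T|T U|T U V|T T' U U']; rewrite /opp_rel.
- exact: Rr.
- exact: Rs.
- exact: Rt.
- by rewrite !opp_stree_join !opp_stree_meet => RT RU; have [] := Rc _ _ _ _ RT RU.
Qed.

Lemma sarc_eq a b : arc_i a = arc_i b -> arc_j a = arc_j b ->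
  arc_A a = arc_A b -> arc_B a = arc_B b -> arc_r a = arc_r b -> a = b.
Proof.
case: a b => i j A B r h1 h2 h3 h4 [i' j' A' B' r' h1' h2' h3' h4'] /= *; subst.
by congr SArc; apply: eq_irrelevance.
Qed.

Lemma arc_memE a l : ((l \in arc_A a) || (l \in arc_B a)) =
  ((arc_i a < l < arc_j a) && (s l != 0)).
Proof. by have /setP/(_ l) := arc_ABE a; rewrite !inE. Qed.

Lemma arc_memN a l : l \in arc_A a -> (l \in arc_B a) = false.
Proof. by move=> lA; have := arc_AB a => /disjointFr ->. Qed.

Lemma arc_memA a l : l \in arc_A a -> [/\ arc_i a < l, l < arc_j a & s l != 0].
Proof. by move=> lA; have := arc_memE a l; rewrite lA /= => /esym /andP[/andP[]]. Qed.

Lemma arc_memB a l : l \in arc_B a -> [/\ arc_i a < l, l < arc_j a & s l != 0].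
Proof. by move=> lB; have := arc_memE a l; rewrite lB orbT => /esym /andP[/andP[]]. Qed.

Fact dual_arc_AB a : [disjoint arc_B a & arc_A a].
Proof. by rewrite disjoint_sym arc_AB. Qed.

Fact dual_arc_ABE a : arc_B a :|: arc_A a =
  [set k : 'I_n | (arc_i a < k < arc_j a) && (s k != 0)].
Proof. by rewrite setUC arc_ABE. Qed.

Fact dual_arc_range a : 1 <= (s (arc_i a)).+1 - arc_r a <= s (arc_i a).
Proof. by have := arc_r_range a; lia. Qed.

Definition dual_arc a : sarc s :=
  SArc (arc_ij a) (dual_arc_AB a) (dual_arc_ABE a) (dual_arc_range a).

Lemma dual_arcK : involutive dual_arc.
Proof. by move=> a; apply: sarc_eq => //=; have := arc_r_range a; lia. Qed.

Lemma subarc_dual a b : subarc a b -> subarc (dual_arc a) (dual_arc b).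
Proof.
move=> [h1 [h2 h2'] h3 h4 h5]; split=> //=.
- by move=> e; rewrite h4 // e.
- by case/h5 => -[m ->]; [right|left]; split=> //; lia.
Qed.

Lemma subarc_refl a : subarc a a.
Proof. by split=> //; rewrite ltnn. Qed.

Lemma ord_ltn_eqF x y : x < y -> (x == y) = false.
Proof. by move=> xy; apply/eqP => e; move: xy; rewrite e ltnn. Qed.

(** * Join irreducible trees *)

(* The position matrix of the join irreducible tree of [a] for [w = arc_r a],
   and that of its lower cover for [w = (arc_r a).-1]. *)
Definition arc_posmx a w x y : nat :=
  if y \in arc_j a |: arc_A a then
    if x == arc_i a then if y == arc_j a then w else arc_r a
    else if x \in arc_B a then s x else 0
  else 0.

Lemma arc_posmx_spec a w : w <= arc_r a ->
  posmx_spec s (enum 'I_n) (arc_posmx a w).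
Proof.
move=> wr x y z _ _ _ xy yz; rewrite /arc_posmx !inE.
have := arc_memE a z; have := arc_memE a y; have := arc_memE a x.
have := @arc_memN a y; have := arc_ij a => ij.
have [iy|yi] := ltnP (arc_i a) y; last first.
  rewrite (ord_ltn_eqF (leq_trans xy yi)).
  by case: (x \in arc_B a) => *; [exfalso; lia | rewrite !if_same].
rewrite [y == arc_i a]eq_sym (ord_ltn_eqF iy).
case: ifP => [hz|_]; last by split.
case: (boolP (y \in arc_B a)) => _ yN _ my mz.
  have -> : (y == arc_j a) || (y \in arc_A a) = false.
    have zj : z <= arc_j a by case/orP: hz mz => [/eqP->//|->]; lia.
    by apply/norP; rewrite -val_eqE /=; move: yN; case: (y \in arc_A a) => [/(_ isT)|]//; lia.
  by split=> //; lia.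
split=> // sy; have zj : z <= arc_j a by case/orP: hz mz => [/eqP->//|->]; lia.
have -> : y \in arc_A a by move: my; rewrite orbF => ->; lia.
rewrite orbT (ord_ltn_eqF (leq_trans yz zj)).
by case: ifP => // _; case: ifP.
Qed.

Lemma arc_posmx_le a w x y : w <= arc_r a -> arc_posmx a w x y <= s x.
Proof.
move=> wr; have := arc_r_range a; rewrite /arc_posmx; case: ifP => // _.
by case: eqP => [->|_]; [case: ifP => _ | case: ifP]; lia.
Qed.

Definition arc_tree a w : stree s := stree_of_posmx s (arc_posmx a w).

Lemma arc_treeE a w x y : w <= arc_r a -> x < y ->
  ps (arc_tree a w) x y = arc_posmx a w x y.
Proof.
move=> wr; apply: stree_of_posmxE; last exact: arc_posmx_spec.
by move=> *; exact: arc_posmx_le.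
Qed.

Definition arc_lower a : stree s := arc_tree a (arc_r a).-1.

Lemma arc_lowerE a x y : x < y -> ps (arc_lower a) x y = arc_posmx a (arc_r a).-1 x y.
Proof. by apply: arc_treeE; exact: leq_pred. Qed.

Lemma slot_rcons_nseq t l m : l \in labels t -> slot (rcons (nseq m Leaf) t) l = m.
Proof. by elim: m => [|m IH] lt; rewrite /slot /= ?lt //= -/(slot _ _) IH. Qed.

Lemma labels_rcons_nseq t m :
  flatten [seq labels w | w <- rcons (nseq m (@Leaf n)) t] = labels t.
Proof. by rewrite map_rcons flatten_rcons flatten_labels_nseq. Qed.

Lemma nth_rcons_nseq t m : nth Leaf (rcons (nseq m (@Leaf n)) t) m = t.
Proof. by rewrite nth_rcons size_nseq ltnn eqxx. Qed.

Lemma pos_rcons_nseq j t x y : is_increasing s (Node j (rcons (nseq (s j) Leaf) t)) ->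
  y \in labels t -> x \in j :: labels t ->
  pos s (Node j (rcons (nseq (s j) Leaf) t)) x y =
    if x == j then 0 else pos s t x y.
Proof.
move=> incr yt; rewrite inE; case: eqVneq => [->|_] xt.
  by rewrite pos_root ?labels_rcons_nseq // slot_rcons_nseq // subnn.
by rewrite pos_children ?labels_rcons_nseq // !slot_rcons_nseq // eqxx nth_rcons_nseq.
Qed.

Lemma right_comb_pos (J : seq 'I_n) x y : sorted (@label_lt n) J ->
  x \in J -> y \in J -> x < y -> pos s (right_comb s J) x y = 0.
Proof.
elim: J => // j J IH jJ xJ; have incr := right_comb_incr s jJ.
rewrite inE => /orP[/eqP->|yJ] xy.
  move: xJ; rewrite inE (ord_ltn_eqF xy) /= => xJ.
  have /allP/(_ x xJ) := order_path_min (@label_lt_trans n) jJ.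
  by rewrite /label_lt; lia.
rewrite pos_rcons_nseq ?right_comb_labels //; case: eqVneq => // nxj.
by apply: IH => //; [exact: path_sorted jJ | move: xJ; rewrite inE (negPf nxj)].
Qed.

Lemma replace_edge_pos (J : seq 'I_n) i k t x y :
  sorted (@label_lt n) J -> i \in J -> k < s i -> is_increasing s t ->
  (forall l, l \in labels t -> i < l) -> uniq (J ++ labels t) ->
  x \in J ++ labels t -> y \in J ++ labels t -> x < y ->
  pos s (replace_edge (right_comb s J) i k t) x y =
    if x \in J then
      if y \in J then 0
      else if x == i then s i - k else if i < x then s x else 0
    else if y \in J then 0 else pos s t x y.
Proof.
move=> sJ iJ ki incr ti; have rt : root_gt i t.
  by case: t incr ti => //= l c _; apply; rewrite inE eqxx.
elim: J sJ iJ => // j J IH jJ.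
have jlt l : l \in J -> j < l.
  by move=> lJ; have /allP/(_ l lJ) := order_path_min (@label_lt_trans n) jJ.
move=> iJ uJ xJ yJ xy.
have jle l : j <= i -> l \in (j :: J) ++ labels t -> j <= l.
  move=> ji; rewrite inE mem_cat => /orP[/eqP->//|/orP[/jlt/ltnW//|/ti il]].
  exact: leq_trans ji (ltnW il).
have [inc perm _] := replace_edge_comb jJ iJ ki incr rt.
have [eij|nji] := eqVneq j i.
  subst j; move: inc perm; rewrite /= eqxx.
  set c := set_nth _ _ _ _ => inc; rewrite perm_cons => perm.
  have uc : uniq (flatten [seq labels w | w <- c]).
    by move: uJ; rewrite (perm_uniq perm) => /andP[].
  have sc : size c = (s i).+1.
    by rewrite size_set_nth size_rcons size_nseq (maxn_idPr _) // ltnS ltnW.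
  have ck : nth Leaf c k = t by rewrite nth_set_nth /= eqxx.
  have cs : nth Leaf c (s i) = right_comb s J.
    by rewrite nth_set_nth /= gtn_eqF // nth_rcons_nseq.
  have kc : k < size c by rewrite sc ltnW.
  have ic : s i < size c by rewrite sc.
  have slt l : l \in labels t -> slot c l = k.
    by move=> lt; apply: slotE; rewrite ?ck.
  have slJ l : l \in J -> slot c l = s i.
    by move=> lJ; apply: slotE; rewrite ?cs ?right_comb_labels.
  have mc l : (l \in flatten [seq labels w | w <- c]) = (l \in J) || (l \in labels t).
    by rewrite (perm_mem perm) mem_cat.
  have dJ l : l \in J -> (l \in labels t) = false.
    move=> lJ; move: uJ; rewrite /= cat_uniq => /and4P[_ _ /hasPn h _].
    by apply/negP => /h; rewrite lJ.
  have iNt : (i \in labels t) = false.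
    by apply/negP => /ti; rewrite ltnn.
  have yi : i < y := leq_ltn_trans (jle _ (leqnn _) xJ) xy.
  move: yJ; rewrite !inE mem_cat [y == i]eq_sym (ord_ltn_eqF yi) /= => yJ.
  move: xJ; rewrite inE mem_cat; case: eqVneq => [->|nxi] /= xJ.
    rewrite pos_root ?mc //; case: (boolP (y \in J)) yJ => [/slJ->|_ /slt ->] //.
    by rewrite subnn.
  rewrite pos_children ?mc //.
  case: (boolP (x \in J)) xJ => [xJ _|xJ xt] /=; last first.
    rewrite (slt _ xt); case: (boolP (y \in J)) yJ => [/slJ->|_ /slt ->] //=.
      by rewrite ltn_eqF // ltnNge ltnW.
    by rewrite eqxx ck.
  rewrite (slJ _ xJ) (jlt _ xJ); case: (boolP (y \in J)) yJ => [yJ _|_ /slt ->] //=.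
    rewrite slJ // eqxx cs right_comb_pos //; exact: path_sorted jJ.
  by rewrite gtn_eqF // ki.
move: iJ; rewrite inE eq_sym (negPf nji) /= => iJ.
have ji := jlt _ iJ.
move: inc perm; rewrite /= (negPf nji) map_rcons map_nseq.
set t' := replace_edge _ _ _ _ => inc; rewrite perm_cons labels_rcons_nseq => perm.
have yi : j < y := leq_ltn_trans (jle _ (ltnW ji) xJ) xy.
move: yJ; rewrite !inE /= [y == j]eq_sym (ord_ltn_eqF yi) /= => yJ.
rewrite pos_rcons_nseq ?(perm_mem perm) //; last first.
  by move: xJ; rewrite !inE (perm_mem perm).
move: uJ => /= /andP[jN uJ]; move: xJ; rewrite inE; case: eqVneq => [->|nxj] /= xJ.
  by rewrite (negPf nji) ltnNge ltnW //=; case: ifP.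
by apply: IH => //; exact: path_sorted jJ.
Qed.

Lemma arc_stree_pos a x y : x < y ->
  ps (arc_stree a) x y = arc_posmx a (arc_r a) x y.
Proof.
move=> xy; have /andP[r0 rs] := arc_r_range a.
have gt l : l \in arc_j a |: arc_A a -> arc_i a < l.
  rewrite !inE => /orP[/eqP->|lA]; first exact: arc_ij.
  by have := arc_memE a l; rewrite lA /=; lia.
rewrite /= /arc_ptree replace_edge_pos ?right_comb_labels //.
- rewrite !mem_enum !in_setC /arc_posmx.
  case: (boolP (y \in _)) => yS /=; last by rewrite !if_same.
  case: (boolP (x \in _)) => xS /=.
    rewrite right_comb_pos ?mem_enum // ?sorted_enum_label //.
    have := gt _ xS; have := arc_memE a x; have := @arc_memN a x.
    move: xS; rewrite !inE => xS xN xE ix.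
    rewrite eq_sym (ord_ltn_eqF ix).
    suff -> : (x \in arc_B a) = false by [].
    case/orP: xS xN xE => [/eqP->|-> ->//]; rewrite ltnn andbF /=.
    by move=> _; case: (_ \in arc_B a); rewrite ?orbT.
  rewrite subKn // if_same; case: eqP => // nxi.
  have := arc_memE a x; have xj : x < arc_j a.
    move: yS; rewrite !inE => /orP[/eqP<-//|yA].
    by have := arc_memE a y; rewrite yA /=; lia.
  move: xS; rewrite !inE negb_or => /andP[_ /negPf ->]; rewrite xj /= => ->.
  by case: ltnP => //= _; case: (s x).
- exact: sorted_enum_label.
- by rewrite mem_enum in_setC; apply/negP => /gt; rewrite ltnn.
- lia.
- exact/right_comb_incr/sorted_enum_label.
- by move=> l; rewrite mem_enum; exact: gt.
- rewrite cat_uniq !enum_uniq andbT; apply/hasPn => l.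
  by rewrite !mem_enum in_setC => ->.
- by rewrite mem_cat !mem_enum in_setC orNb.
- by rewrite mem_cat !mem_enum in_setC orNb.
Qed.

Lemma arc_posmx_ij a w : arc_posmx a w (arc_i a) (arc_j a) = w.
Proof. by rewrite /arc_posmx !inE !eqxx. Qed.

Lemma arc_posmx_other a w w' x y : (x == arc_i a) && (y == arc_j a) = false ->
  arc_posmx a w x y = arc_posmx a w' x y.
Proof. by rewrite /arc_posmx; case: (x == _) => //= ->. Qed.

Lemma arc_lower_lt a : (arc_lower a < arc_stree a)%O.
Proof.
have /andP[r0 _] := arc_r_range a.
rewrite lt_neqAle; apply/andP; split.
  apply/eqP => /(congr1 (fun T => ps T (arc_i a) (arc_j a))).
  by rewrite arc_lowerE ?arc_ij // arc_stree_pos ?arc_ij // !arc_posmx_ij; lia.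
apply/sleP => x y xy; rewrite arc_lowerE // arc_stree_pos //.
have [/andP[/eqP-> /eqP->]|/negbTE h] := boolP ((x == arc_i a) && (y == arc_j a)).
  by rewrite !arc_posmx_ij leq_pred.
by rewrite (arc_posmx_other _ (arc_r a) h).
Qed.

(* The entry [(i, j)] of a tree below the join irreducible [J] controls the
   whole of [J]: lowering any other entry of [J] forces this one down. *)
Lemma arc_stree_ge a T : (T <= arc_stree a)%O ->
  arc_r a <= ps T (arc_i a) (arc_j a) -> (arc_stree a <= T)%O.
Proof.
have /andP[r0 _] := arc_r_range a.
move=> /sleP TJ rT.
have rT' l : l \in arc_j a |: arc_A a -> arc_r a <= ps T (arc_i a) l.
  rewrite !inE => /orP[/eqP->//|lA]; have [il lj sl] := arc_memA lA.
  apply: leq_trans rT _; apply: pos_cotrans => //.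
  apply: leq_ltn_trans (TJ _ _ lj) _; rewrite arc_stree_pos // /arc_posmx.
  by rewrite !inE eqxx [l == _]eq_sym (ord_ltn_eqF il) (arc_memN lA) /=; lia.
apply/sleP => x y xy; rewrite arc_stree_pos // /arc_posmx.
case: ifP => // yS; have rTy := rT' y yS.
case: eqP => [->|_]; first by case: ifP.
case: ifP => // xB; rewrite leqNgt; apply/negP => Txy.
have [ix xj _] := arc_memB xB.
have := leq_trans (leq_trans rTy (pos_cotrans ix xy Txy)) (TJ _ _ ix).
rewrite arc_stree_pos // /arc_posmx !inE (ord_ltn_eqF xj).
have -> : (x \in arc_A a) = false by apply/negP => /arc_memN; rewrite xB.
by rewrite /=; lia.
Qed.

Lemma arc_lower_max a T : (T < arc_stree a)%O -> (T <= arc_lower a)%O.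
Proof.
rewrite lt_leAnge => /andP[TJ]; move: (TJ) => /sleP TJp JT.
apply/sleP => x y xy; rewrite arc_lowerE //.
have [/andP[/eqP-> /eqP->]|/negbTE h] := boolP ((x == arc_i a) && (y == arc_j a)).
  rewrite arc_posmx_ij; move: JT; apply: contraR => h.
  by apply: arc_stree_ge => //; lia.
by rewrite (arc_posmx_other _ (arc_r a) h) -arc_stree_pos ?TJp.
Qed.

Lemma arc_lower_cover a : unique_lower_cover (arc_stree a) (arc_lower a).
Proof. by apply: lower_coverP => [|T]; [exact: arc_lower_lt | exact: arc_lower_max]. Qed.

(* [opp_stree (arc_stree (dual_arc b))] is the meet irreducible tree of [b]. *)
Lemma subarc_lower_le a b : subarc a b ->
  arc_i b = arc_i a \/ arc_i a \in arc_A b ->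
  arc_j a = arc_j b \/ arc_j a \in arc_B b ->
  (arc_lower a <= opp_stree (arc_stree (dual_arc b)))%O /\
  ~~ (arc_stree a <= opp_stree (arc_stree (dual_arc b)))%O.
Proof.
move=> [[ii jj] [/subsetP AA /subsetP BB] _ ri rlt] ia ja.
have /andP[r0 rs] := arc_r_range a; have := arc_r_range b.
have ij := arc_ij a; have ijb := arc_ij b => rb.
have e : arc_posmx (dual_arc b) (arc_r (dual_arc b)) (arc_i a) (arc_j a) =
    (s (arc_i a)).+1 - arc_r a.
  rewrite /arc_posmx !inE /= if_same.
  have -> : (arc_j a == arc_j b) || (arc_j a \in arc_B b).
    by case: ja => ->; rewrite ?eqxx ?orbT.
  case: ia => [iE|iA]; first by rewrite -iE eqxx -ri // iE.
  have [iba _ _] := arc_memA iA.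
  rewrite eq_sym (ord_ltn_eqF iba) iA.
  by have [[_ ->]|[]] := rlt iba; [lia | rewrite (arc_memN iA)].
split; last first.
  apply/negP => /sleP/(_ _ _ ij); rewrite opp_streeE // !arc_stree_pos // e.
  by rewrite arc_posmx_ij; lia.
apply/sleP => x y xy; rewrite opp_streeE // arc_lowerE // arc_stree_pos //.
have [/andP[/eqP-> /eqP->]|/negbTE h] := boolP ((x == arc_i a) && (y == arc_j a)).
  by rewrite e arc_posmx_ij; lia.
suff : arc_posmx a (arc_r a).-1 x y = 0 \/
       arc_posmx (dual_arc b) (arc_r (dual_arc b)) x y = 0.
  case=> ->; first by [].
  by rewrite subn0 arc_posmx_le // leq_pred.
rewrite /arc_posmx; have [ya|] := boolP (y \in arc_j a |: arc_A a); last by left.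
have [yb|] := boolP (y \in arc_j (dual_arc b) |: _); last by right.
have [yj|yj] := eqVneq y (arc_j a); last first.
  move: ya yb; rewrite !inE (negPf yj) /= => /[dup] /arc_memA[_ ya _] /AA /arc_memN ->.
  by rewrite orbF => /eqP yb; move: ya; rewrite yb; lia.
move: h; rewrite yj eqxx andbT => ->; case: ifP => [xB|]; last by left.
have [ix _ _] := arc_memB xB; right; rewrite eq_sym (ord_ltn_eqF (leq_ltn_trans ii ix)).
by case: ifP => // /arc_memN; rewrite BB.
Qed.

(** * Subarcs are forced *)

Definition arc_contracted (R : stree s -> stree s -> Prop) a :=
  R (arc_stree a) (arc_lower a).

Lemma arc_contracted_opp R a b : lattice_congruence R -> subarc a b ->
  arc_i b = arc_i a \/ arc_i a \in arc_A b ->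
  arc_j a = arc_j b \/ arc_j a \in arc_B b ->
  arc_contracted R a -> arc_contracted (opp_rel R) (dual_arc b).
Proof.
move=> Rc ab ia ja Ra; have [_ Rs _ _] := Rc; apply: Rs.
have [lm jm] := subarc_lower_le ab ia ja.
apply: (congruence_up Rc lm jm) Ra; first by rewrite opp_stree_le ltW ?arc_lower_lt.
move=> T; rewrite opp_stree_le_swap => mT; apply: arc_lower_max; move: mT.
by rewrite !lt_leAnge opp_stree_le_swap le_opp_stree_swap.
Qed.

Lemma arc_contracted_dual R a : lattice_congruence R ->
  arc_contracted (opp_rel R) (dual_arc a) <-> arc_contracted R a.
Proof.
have dual Q b : lattice_congruence Q ->
    arc_contracted Q b -> arc_contracted (opp_rel Q) (dual_arc b).
  by move=> Qc; apply: arc_contracted_opp => //; [exact: subarc_refl | left..].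
move=> Rc; split; last exact: dual.
move/(dual _ _ (opp_rel_congruence Rc)).
by rewrite dual_arcK /arc_contracted /opp_rel !opp_streeK.
Qed.

Lemma arc_contracted_sub_opp R a b : lattice_congruence R -> subarc a b ->
  arc_i b = arc_i a \/ arc_i a \in arc_A b ->
  arc_j a = arc_j b \/ arc_j a \in arc_B b ->
  arc_contracted R a -> arc_contracted R b.
Proof.
by move=> Rc ab ia ja Ra; apply/arc_contracted_dual/(arc_contracted_opp Rc ab).
Qed.

Lemma arc_contracted_sub_end R a b : lattice_congruence R -> subarc a b ->
  arc_i b = arc_i a \/ arc_j a = arc_j b ->
  arc_contracted R a -> arc_contracted R b.
Proof.
move=> Rc ab e Ra; have [[ii jj] _ sj _ rlt] := ab.
have dual : arc_i b = arc_i a \/ arc_i a \in arc_B b ->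
    arc_j a = arc_j b \/ arc_j a \in arc_A b -> arc_contracted R b.
  move=> ia ja; apply/(arc_contracted_dual b Rc).
  apply: (arc_contracted_sub_opp (opp_rel_congruence Rc) (subarc_dual ab) ia ja).
  exact/(arc_contracted_dual a Rc).
have ia : [\/ arc_i b = arc_i a, arc_i a \in arc_A b | arc_i a \in arc_B b].
  case: (ltngtP (arc_i b) (arc_i a)) ii => // [/rlt[]|/val_inj ? _]; last by constructor 1.
    by case=> *; constructor 2.
  by case=> *; constructor 3.
have ja : [\/ arc_j a = arc_j b, arc_j a \in arc_B b | arc_j a \in arc_A b].
  case: (ltngtP (arc_j a) (arc_j b)) jj => // [jlt|/val_inj ?] _; last by constructor 1.
  have := arc_memE b (arc_j a); have [/sj ej|] := posnP (s (arc_j a)).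
    by move: jlt; rewrite ej ltnn.
  move=> _; rewrite jlt (leq_ltn_trans ii (arc_ij a)) => /orP[?|?];
    by [constructor 3 | constructor 2].
case: e => e.
  by case: ja => ja; [apply: dual; left | apply: (arc_contracted_sub_opp Rc ab) Ra; [left|right]
    | apply: dual; [left|right]].
by case: ia => ia; [apply: dual; left | apply: (arc_contracted_sub_opp Rc ab) Ra; [right|left]
    | apply: dual; [right|left]].
Qed.

Section Restriction.
Variables (b : sarc s) (p q : 'I_n) (r : nat).
Hypotheses (ip : arc_i b <= p) (pq : p < q) (qj : q <= arc_j b).
Hypothesis rp : 1 <= r <= s p.

Fact restrict_arc_AB : [disjoint [set l in arc_A b | p < l < q]
                               & [set l in arc_B b | p < l < q]].
Proof.
apply/pred0P => l /=; rewrite !inE.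
by case: (boolP (l \in arc_A b)) => // /arc_memN->; rewrite andbF.
Qed.

Fact restrict_arc_ABE :
  [set l in arc_A b | p < l < q] :|: [set l in arc_B b | p < l < q] =
  [set k : 'I_n | (p < k < q) && (s k != 0)].
Proof. by apply/setP => l; rewrite !inE -andb_orl arc_memE; lia. Qed.

Definition restrict_arc : sarc s :=
  SArc pq restrict_arc_AB restrict_arc_ABE rp.
End Restriction.

Lemma arc_contracted_sub R a b : lattice_congruence R -> subarc a b ->
  arc_contracted R a -> arc_contracted R b.
Proof.
move=> Rc ab; have [[ii jj] [/subsetP AA /subsetP BB] sj rE rlt] := ab.
pose c := restrict_arc (leqnn _) (leq_ltn_trans ii (arc_ij a)) jj (arc_r_range b).
move=> Ra; apply: (@arc_contracted_sub_end R c b) => //; last first.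
- apply: (@arc_contracted_sub_end R a c) => //; last by right.
  split=> //=; first by split; apply/subsetP => l lS; rewrite inE ?AA ?BB //;
    [case: (arc_memA lS) | case: (arc_memB lS)] => il lj _;
    rewrite lj (leq_ltn_trans ii il).
  move=> /[dup] /rlt [] [ia ->] il; [left|right]; split=> //;
    by rewrite inE ia il arc_ij.
- by left.
by split=> //=; [split; apply/subsetP => l; rewrite inE => /andP[] | rewrite ltnn].
Qed.

(** * The congruence of the subarcs of an arc *)

(* The threshold of [b] at [l] is the parameter [r] of the subarcs of [b]
   starting at [l]. *)
Definition threshold b l :=
  if l == arc_i b then arc_r b else if l \in arc_A b then 1 else s l.

Definition above b T u v := threshold b u <= ps T u v.

Definition arc_window b p q u v :=
  [&& u < v, (u == p) || ((u \in arc_B b) && (p < u)) &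
             (v == q) || ((v \in arc_A b) && (v < q))].

Definition above_arc b T p q :=
  [forall u, forall v, arc_window b p q u v ==> above b T u v].

Lemma above_arcP b T p q :
  reflect (forall u v, arc_window b p q u v -> above b T u v) (above_arc b T p q).
Proof.
apply: (iffP forallP) => [h u v|h u]; last by apply/forallP => v; apply/implyP/h.
by have /forallP/(_ v)/implyP := h u.
Qed.

Definition arc_start b p := (p == arc_i b) || (p \in arc_A b :|: arc_B b).
Definition arc_end b q := (q == arc_j b) || (q \in arc_A b :|: arc_B b).

Definition arc_equiv b T U : Prop := forall p q,
  arc_start b p -> arc_end b q -> p < q -> above_arc b T p q = above_arc b U p q.

Lemma above_dual b T u v : u < v -> arc_start b u ->
  above (dual_arc b) (opp_stree T) u v = ~~ above b T u v.
Proof.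
move=> uv; rewrite /above /threshold /arc_start opp_streeE //= inE.
have := pos_le s (stree_val T) u v; have := arc_r_range b.
case: eqVneq => [->|_] /=; first lia.
have [/arc_memN ->|_] := boolP (u \in arc_A b); first lia.
by case: ifP => //=; lia.
Qed.

Lemma threshold_range b u : arc_start b u -> 1 <= threshold b u <= s u.
Proof.
rewrite /threshold /arc_start inE; case: eqP => [-> _|_ /=].
  exact: arc_r_range.
by case: ifP => [/arc_memA[]|_ /= /arc_memB[]]; lia.
Qed.

Lemma thresholdA b u : u \in arc_A b -> threshold b u = 1.
Proof.
by move=> uA; have [iu _ _] := arc_memA uA; rewrite /threshold eq_sym ord_ltn_eqF ?uA.
Qed.

Lemma thresholdB b u : u \in arc_B b -> threshold b u = s u.
Proof.
move=> uB; have [iu _ _] := arc_memB uB; rewrite /threshold eq_sym ord_ltn_eqF //.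
by case: ifP => // /arc_memN; rewrite uB.
Qed.

Lemma arc_start_le b p : arc_start b p -> arc_i b <= p.
Proof.
by rewrite /arc_start inE => /or3P[/eqP->|/arc_memA[/ltnW]|/arc_memB[/ltnW]].
Qed.

Lemma arc_end_le b q : arc_end b q -> q <= arc_j b.
Proof.
by rewrite /arc_end inE => /or3P[/eqP->|/arc_memA[_ /ltnW]|/arc_memB[_ /ltnW]].
Qed.

Lemma above_arcE b T p q (bp : arc_start b p) (bq : arc_end b q) (pq : p < q) :
  above_arc b T p q = (arc_stree (restrict_arc (arc_start_le bp) pq
                         (arc_end_le bq) (threshold_range bp)) <= T)%O.
Proof.
apply/above_arcP/sleP => h u v.
  move=> uv; rewrite arc_stree_pos // /arc_posmx /= if_same.
  case: ifP => //; rewrite !inE => vA.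
  have bv : (v == q) || ((v \in arc_A b) && (v < q)).
    by case: (v == q) vA => //= /and3P[-> _ ->].
  case: eqVneq => [up|_].
    by rewrite -up; apply: h; rewrite /arc_window uv up eqxx.
  case: ifP => // /and3P[uB pu _]; rewrite -(thresholdB uB).
  by apply: h; rewrite /arc_window uv uB pu bv orbT.
move=> /and3P[uv pu qv]; have := h _ _ uv; rewrite arc_stree_pos // /arc_posmx /= if_same.
rewrite !inE; have puv : p < v by case/orP: pu => [/eqP<-//|/andP[_ pu]]; lia.
have uq : u < q by case/orP: qv => [/eqP<-//|/andP[_ vq]]; lia.
have -> : (v == q) || (v \in arc_A b) && (p < v < q).
  by case/orP: qv => [->//|/andP[-> ->]]; rewrite puv orbT.
rewrite /above; case: eqVneq pu => [->//|_ /= /andP[uB pu]].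
by rewrite uB pu uq /= (thresholdB uB).
Qed.

(* Among the pairs of the window that are above their threshold, take [(u, v)]
   with [v - u] minimal: the whole subarc from [u] to [v] is then above. *)
Lemma above_arc_dualP b T p q : arc_start b p -> arc_end b q ->
  reflect (exists u v, arc_window (dual_arc b) p q u v /\ above_arc b T u v)
          (~~ above_arc (dual_arc b) (opp_stree T) p q).
Proof.
move=> bp bq.
have start u v : arc_window (dual_arc b) p q u v -> arc_start b u.
  by move=> /and3P[_ + _] => /orP[/eqP->//|/andP[/= uA _]]; rewrite /arc_start inE uA orbT.
apply: (iffP idP); last first.
  move=> [u [v [win /above_arcP ab]]]; have /and3P[uv _ _] := win.
  apply/negP => /above_arcP/(_ _ _ win).
  by rewrite above_dual ?(start _ _ win) // ab // /arc_window uv !eqxx.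
move=> nab; pose P w := arc_window (dual_arc b) p q w.1 w.2 && above b T w.1 w.2.
have [w0 Pw0] : exists w, P w.
  move: nab; rewrite negb_forall => /existsP[u]; rewrite negb_forall => /existsP[v].
  rewrite negb_imply => /andP[win]; have /and3P[uv _ _] := win.
  rewrite above_dual ?(start _ _ win) // negbK => abv.
  by exists (u, v); rewrite /P win.
case: (arg_minnP (fun w : 'I_n * 'I_n => w.2 - w.1) Pw0) => -[u v] /andP[/= win ab] wmin.
exists u, v; split=> //; have /and3P[uv pu vq] := win.
have pu' : p <= u by case/orP: pu => [/eqP->//|/andP[_ /ltnW]].
have vq' : v <= q by case/orP: vq => [/eqP->//|/andP[_ /ltnW]].
have aboveA l : l \in arc_A b -> u < l -> l < v -> above b T u l.
  move=> lA ul lv; apply: leq_trans ab _; apply: pos_cotrans => //.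
  have [_ _ sl] := arc_memA lA; rewrite ltnNge; apply/negP => sl'.
  have : P (l, v).
    rewrite /P /= /arc_window lv vq /= lA (leq_ltn_trans pu' ul) orbT /above.
    by rewrite thresholdA //; lia.
  by move/wmin => /=; lia.
have aboveu l : u < l -> (l == v) || ((l \in arc_A b) && (l < v)) -> above b T u l.
  by move=> ul /orP[/eqP->//|/andP[lA lv]]; exact: aboveA.
apply/above_arcP => x y /and3P[xy ux yv].
case/orP: ux => [/eqP xu|/andP[xB ux]]; first by rewrite xu; apply: aboveu; rewrite -?xu.
have xv : x < v by case/orP: yv => [/eqP<-//|/andP[_]]; lia.
have uy := aboveu y (ltn_trans ux xy) yv.
rewrite /above thresholdB // leqNgt; apply/negP => /(pos_cotrans ux xy) yx.
have : P (u, x).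
  rewrite /P /= /arc_window ux pu /= xB (leq_trans xv vq') orbT /=.
  exact: leq_trans uy yx.
by move/wmin => /=; lia.
Qed.

Lemma arc_equiv_opp b T U : arc_equiv b T U ->
  arc_equiv (dual_arc b) (opp_stree T) (opp_stree U).
Proof.
have opp X Y p q : arc_equiv b X Y -> arc_start b p -> arc_end b q ->
    ~~ above_arc (dual_arc b) (opp_stree X) p q ->
    ~~ above_arc (dual_arc b) (opp_stree Y) p q.
  move=> XY bp bq /(above_arc_dualP _ bp bq)[u [v [win Xuv]]].
  apply/above_arc_dualP => //; exists u, v; split=> //.
  have /and3P[uv pu qv] := win; rewrite -XY //.
    by case/orP: pu => [/eqP->//|/andP[/= uA _]]; rewrite /arc_start inE uA orbT.
  by case/orP: qv => [/eqP->//|/andP[/= vB _]]; rewrite /arc_end inE vB !orbT.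
move=> TU p q; rewrite /arc_start /arc_end /= setUC => bp bq _.
apply: negb_inj; apply/idP/idP; apply: opp => //.
by move=> x y bx yb xy; rewrite TU.
Qed.

Lemma arc_equiv_meet b T T' U U' : arc_equiv b T T' -> arc_equiv b U U' ->
  arc_equiv b (T `&` U)%O (T' `&` U')%O.
Proof.
move=> TT UU p q bp bq pq; have := TT p q bp bq pq; have := UU p q bp bq pq.
by rewrite !(above_arcE _ bp bq pq) !lexI => -> ->.
Qed.

Lemma arc_equiv_congruence b : lattice_congruence (arc_equiv b).
Proof.
split=> [T p q //|T U TU p q bp bq pq|T U V TU UV p q bp bq pq|T T' U U' TT UU].
- by rewrite TU.
- by rewrite TU // UV.
split; last exact: arc_equiv_meet.
have := arc_equiv_meet (arc_equiv_opp TT) (arc_equiv_opp UU).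
by move/arc_equiv_opp; rewrite -!opp_stree_join dual_arcK !opp_streeK.
Qed.

Lemma above_arc_subarc a b p q : arc_start b p -> arc_end b q ->
  above_arc b (arc_stree a) p q -> ~~ above_arc b (arc_lower a) p q -> subarc a b.
Proof.
move=> bp bq /above_arcP Ja; rewrite negb_forall => /existsP[u].
rewrite negb_forall => /existsP[v]; rewrite negb_imply => /andP[win].
have /and3P[uv pu qv] := win; have := Ja _ _ win.
rewrite /above arc_stree_pos // arc_lowerE //.
have [/andP[/eqP ui /eqP vj]|/negbTE h] := boolP ((u == arc_i a) && (v == arc_j a));
  last by rewrite (arc_posmx_other _ (arc_r a) h) => ->.
subst u v; rewrite !arc_posmx_ij -ltnNge => t1 t2.
have rt : arc_r a = threshold b (arc_i a) by lia.
have bi : arc_start b (arc_i a).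
  by case/orP: pu => [/eqP->//|/andP[/= uB _]]; rewrite /arc_start inE uB !orbT.
have bj : arc_end b (arc_j a).
  by case/orP: qv => [/eqP->//|/andP[/= vA _]]; rewrite /arc_end inE vA orbT.
have pi : p <= arc_i a by case/orP: pu => [/eqP->//|/andP[_ /ltnW]].
have jq : arc_j a <= q by case/orP: qv => [/eqP->//|/andP[_ /ltnW]].
have ii := arc_start_le bi; have jj := arc_end_le bj.
have /andP[r0 _] := arc_r_range a.
split=> //.
- split; apply/subsetP => l lS.
    have [il lj sl] := arc_memA lS; have := arc_memE b l.
    rewrite (leq_ltn_trans ii il) (leq_trans lj jj) sl /= => /orP[//|lB].
    have : above b (arc_stree a) l (arc_j a).
      by apply: Ja; rewrite /arc_window lj qv lB (leq_ltn_trans pi il) orbT.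
    rewrite /above thresholdB // arc_stree_pos // /arc_posmx (arc_memN lS).
    by rewrite !inE eqxx [l == _]eq_sym (ord_ltn_eqF il) /=; lia.
  have [il lj sl] := arc_memB lS; have := arc_memE b l.
  rewrite (leq_ltn_trans ii il) (leq_trans lj jj) sl /= => /orP[lA|//].
  have : above b (arc_stree a) (arc_i a) l.
    by apply: Ja; rewrite /arc_window il pu lA (leq_trans lj jq) orbT.
  rewrite /above -rt arc_stree_pos // /arc_posmx !inE (ord_ltn_eqF lj) /=.
  by case: ifP => [/arc_memN|]; [rewrite lS | lia].
- by move=> sj; move: bj; rewrite /arc_end inE => /or3P[/eqP->//|/arc_memA[]|/arc_memB[]];
    rewrite sj.
- by move=> e; rewrite rt /threshold -e eqxx.
move=> ilt; rewrite rt; move: bi; rewrite /arc_start inE eq_sym (ord_ltn_eqF ilt) /=.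
by case/orP => h; [left; rewrite thresholdA | right; rewrite thresholdB].
Qed.

Lemma arc_equiv_lower a b :
  subarc a b \/ arc_equiv b (arc_stree a) (arc_lower a).
Proof.
have [/existsP[p /existsP[q]]|/existsPn none] := boolP [exists p, exists q,
    [&& arc_start b p, arc_end b q, above_arc b (arc_stree a) p q &
        ~~ above_arc b (arc_lower a) p q]].
  by case/and4P => bp bq Ja Ja'; left; exact: above_arc_subarc bp bq Ja Ja'.
right=> p q bp bq pq; apply/idP/idP => [Ja|].
  by have /existsPn/(_ q) := none p; rewrite bp bq Ja negbK.
by rewrite !(above_arcE _ bp bq pq) => /le_trans-> //; exact/ltW/arc_lower_lt.
Qed.

Lemma arc_equivN_lower a : ~ arc_equiv a (arc_stree a) (arc_lower a).
Proof.
have bi : arc_start a (arc_i a) by rewrite /arc_start eqxx.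
have bj : arc_end a (arc_j a) by rewrite /arc_end eqxx.
move=> /(_ _ _ bi bj (arc_ij a)); rewrite !(above_arcE _ bi bj (arc_ij a)).
set c := restrict_arc _ _ _ _; have -> : c = a.
  apply: sarc_eq => //=; last by rewrite /threshold eqxx.
    apply/setP => l; rewrite inE andbC andb_idl //.
    by case/arc_memA => -> ->.
  apply/setP => l; rewrite inE andbC andb_idl //.
  by case/arc_memB => -> ->.
by rewrite lexx; have := arc_lower_lt a; rewrite lt_leAnge => /andP[_ /negPf->].
Qed.
End Forcing.

Theorem theorem72 (n : nat) (hn : 0 < n) (s : 'I_n -> nat) (a a' : sarc s) :
  forces (arc_stree a) (arc_stree a') <-> subarc a a'.
Proof.
split=> [F|aa' R Rc]; last first.
  by rewrite !(contractedE _ (arc_lower_cover _)); exact: arc_contracted_sub.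
have [//|Ra] := arc_equiv_lower a a'; case: (@arc_equivN_lower _ _ a').
have := F _ (arc_equiv_congruence a').
by rewrite !(contractedE _ (arc_lower_cover _)); apply.
Qed.
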